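(* Let $d\geq 1$ be an integer, let $0\leq \alpha<d$, and let $1<p\le q<\infty$ satisfy $\frac1q=\frac1p-\frac{\alpha}{d}$. Put $p'=p/(p-1)$. Then for every weight $w$ on $\mathbb{R}^d$ in the class $A_{q/p'+1}$ and every locally integrable function $\varphi$ on $\mathbb{R}^d$, $$\|\mathcal{M}^\alpha_d\varphi\|_{L^q(w)}\leq \inf_{1<r<q/p'+1}\left\{[w]_{A_r}^{1/(q-s)}\left(\frac{q}{s}\right)^{1/(q-s)}\right\}\|\varphi\|_{L^p(w^{p/q})},$$ where, for each $r$, $$s=s(r,p,\alpha)=q-\frac{rq^2}{(r-1)(q-p)+pq}.$$
   Context: A weight is a locally integrable, positive function $w$ on $\mathbb{R}^d$. All cubes have sides parallel to the coordinate axes and $|Q|$ is the Lebesgue measure of $Q$. For $1<r<\infty$, $$[w]_{A_r}=\sup_Q\left(\frac1{|Q|}\int_Q w\right)\left(\frac1{|Q|}\int_Q w^{-1/(r-1)}\right)^{r-1}\in[1,\infty],$$ the supremum being over all cubes $Q\subset\mathbb{R}^d$; $w\in A_r$ means $[w]_{A_r}<\infty$. Values of $r$ with $[w]_{A_r}=\infty$ contribute $+\infty$ to the infimum. For a positive function $\omega$, $\|\varphi\|_{L^p(\omega)}=\left(\int_{\mathbb{R}^d}|\varphi|^p\omega\,du\right)^{1/p}$ (possibly $+\infty$). Dyadic cubes are the cubes formed by the grids $2^{-N}\mathbb{Z}^d$, $N\in\mathbb{Z}$. The dyadic fractional maximal operator (the subscript $d$ stands for ''dyadic'') is $$\mathcal{M}^\alpha_d\varphi(x)=\sup\left\{|Q|^{\frac{\alpha}{d}-1}\int_Q|\varphi(u)|\,du: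 Q\subset\mathbb{R}^d\text{ is a dyadic cube containing }x\right\}.$$ *)

(* Defs.v *)
From HB Require Import structures.
From mathcomp Require Import all_boot all_order all_algebra.
From mathcomp Require Import all_classical all_reals all_analysis.

Set Implicit Arguments.
Unset Strict Implicit.
Unset Printing Implicit Defensive.

Import Order.TTheory GRing.Theory Num.Theory.
Import numFieldNormedType.Exports.

Local Open Scope classical_set_scope.
Local Open Scope ring_scope.

(** The library has the Borel sigma-algebra on [n.-tuple R] but no measure on
    it.  The Borel-Lebesgue measure is obtained as an iterated product, moved
    to row vectors (which carry the topology of R^d) as an outer measure, and
    completed by Caratheodory's criterion, so that "measurable" below means
    Lebesgue measurable. *)

Section tuple_lebesgue_succ.
Context {R : realType} (n : nat).
Local Notation mR := (measurableTypeR R).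
Variable mu : {sigma_finite_measure set (n.-tuple mR) -> \bar R}.

Definition tcons (x : mR * n.-tuple mR) : n.+1.-tuple mR :=
  [the n.+1.-tuple mR of x.1 :: x.2].

Lemma measurable_tcons : measurable_fun [set: mR * n.-tuple mR] tcons.
Proof. exact: measurable_cons. Qed.

Definition tuple_lebesgue_succ : set (n.+1.-tuple mR) -> \bar R :=
  pushforward (lebesgue_measure \x mu)%E tcons.

HB.instance Definition _ := Measure.copy tuple_lebesgue_succ
  (measure_function_pushforward__canonical__measure_function_Measure
    (lebesgue_measure \x mu)%E measurable_tcons).

Let tuple_lebesgue_succ_sigma_finite : sigma_finite setT tuple_lebesgue_succ.
Proof.
pose g (t : n.+1.-tuple mR) : mR * n.-tuple mR :=
  (tnth t ord0, [tuple of behead t]).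
have mg : measurable_fun setT g.
  apply/measurable_fun_pairP; split => /=.
    exact: measurable_tnth.
  exact: measurable_behead.
have gK : g \o tcons = id.
  by apply/funext => -[x t]; congr pair; exact/val_inj.
have /sigma_finiteP[F [TF ndF mF]] := sigma_finiteT (@lebesgue_measure R).
have /sigma_finiteP[G [TG ndG mG]] := sigma_finiteT mu.
exists (fun k => g @^-1` (F k `*` G k)).
  rewrite -preimage_bigcup -[LHS](preimage_setT g); congr (_ @^-1` _).
  apply/seteqP; split => // -[x t] _.
  have [i _ Fx] : (\bigcup_k F k) x by rewrite -TF.
  have [j _ Gt] : (\bigcup_k G k) t by rewrite -TG.
  exists (maxn i j) => //; split => /=.
    by move: Fx; apply/subsetPset/ndF/leq_maxl.
  by move: Gt; apply/subsetPset/ndG/leq_maxr.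
move=> k; have [mFk Foo] := mF k; have [mGk Goo] := mG k; split.
  by rewrite -[X in measurable X]setTI; apply: mg => //; exact: measurableX.
rewrite /tuple_lebesgue_succ /pushforward -comp_preimage gK preimage_id.
by rewrite product_measure1E// lte_mul_pinfty// ge0_fin_numE.
Qed.

HB.instance Definition _ := @Measure_isSigmaFinite.Build _ _ _
  tuple_lebesgue_succ tuple_lebesgue_succ_sigma_finite.

End tuple_lebesgue_succ.

Fixpoint tuple_lebesgue (R : realType) (n : nat) :
    {sigma_finite_measure set (n.-tuple (measurableTypeR R)) -> \bar R} :=
  match n with
  | 0 => [the {sigma_finite_measure set _ -> \bar R} of \d_[tuple]]
  | m.+1 => [the {sigma_finite_measure set _ -> \bar R} of
              tuple_lebesgue_succ (tuple_lebesgue R m)]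
  end.

Section outer_lebesgue.
Context (R : realType) (d : nat).

Definition row_of_tuple (t : d.-tuple (measurableTypeR R)) : 'rV[R]_d :=
  \row_i tnth t i.

Definition outer_lebesgue (A : set 'rV[R]_d) : \bar R :=
  mu_ext (tuple_lebesgue R d) (row_of_tuple @^-1` A).

Let outer_lebesgue0 : outer_lebesgue set0 = 0%E.
Proof. by rewrite /outer_lebesgue preimage_set0 outer_measure0. Qed.

Let outer_lebesgue_ge0 A : (0 <= outer_lebesgue A)%E.
Proof. exact: outer_measure_ge0. Qed.

Let le_outer_lebesgue : {homo outer_lebesgue : A B / A `<=` B >-> (A <= B)%E}.
Proof. by move=> A B AB; apply: le_outer_measure; exact: preimage_subset. Qed.

Let outer_lebesgue_sigma_subadditive : sigma_subadditive outer_lebesgue.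
Proof.
move=> F; rewrite /outer_lebesgue preimage_bigcup.
exact: outer_measure_sigma_subadditive.
Qed.

HB.instance Definition _ := isOuterMeasure.Build R 'rV[R]_d outer_lebesgue
  outer_lebesgue0 outer_lebesgue_ge0 le_outer_lebesgue
  outer_lebesgue_sigma_subadditive.

End outer_lebesgue.

(** [Rd R d] is [ 'rV[R]_d ] with the sigma-algebra of Lebesgue measurable
    sets. *)
Notation Rd R d := (caratheodory_type (@outer_lebesgue R d)).

Definition lebesgue (R : realType) (d : nat) : set (Rd R d) -> \bar R :=
  @outer_lebesgue R d.

Section lebesgue_is_measure.
Context (R : realType) (d : nat).

Let lebesgue0 : @lebesgue R d set0 = 0%E.
Proof. exact: outer_measure0. Qed.

Let lebesgue_ge0 A : (0 <= @lebesgue R d A)%E.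
Proof. exact: outer_measure_ge0. Qed.

Let lebesgue_sigma_additive : semi_sigma_additive (@lebesgue R d).
Proof. exact: caratheodory_measure_sigma_additive. Qed.

HB.instance Definition _ := isMeasure.Build _ _ _ (@lebesgue R d)
  lebesgue0 lebesgue_ge0 lebesgue_sigma_additive.

End lebesgue_is_measure.

Section box_volume.
Context (R : realType).
Local Notation mR := (measurableTypeR R).

Lemma measurable_tuple_box n (A : 'I_n -> set mR) :
  (forall i, measurable (A i)) ->
  measurable [set t : n.-tuple mR | forall i, A i (tnth t i)].
Proof.
move=> mA.
rewrite (_ : mkset _ =
    \big[setI/setT]_(i <- index_enum 'I_n) ((fun t => tnth t i) @^-1` A i)).
  apply: bigsetI_measurable => i _; rewrite -[X in measurable X]setTI.
  exact: (measurable_tnth i) (mA i).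
rewrite -bigcap_seq; apply/seteqP; split => t /= At i; first by move=> _; exact: At.
by apply: At => /=; rewrite mem_index_enum.
Qed.

Lemma tuple_lebesgue_box n (A : 'I_n -> set mR) :
  (forall i, measurable (A i)) ->
  tuple_lebesgue R n [set t | forall i, A i (tnth t i)] =
  (\prod_(i < n) lebesgue_measure (A i))%E.
Proof.
elim: n A => [|n IHn] A mA /=.
  rewrite big_ord0 (_ : mkset _ = setT); last by apply/seteqP; split => // t _ [].
  by rewrite diracT.
rewrite big_ord_recl -IHn//.
have mB := @measurable_tuple_box n (fun i => A (lift ord0 i)) (fun i => mA _).
rewrite -(product_measure1E _ _ (mA ord0) mB).
rewrite /tuple_lebesgue_succ /pushforward; congr (_ _).
apply/seteqP; split => -[x t] /=.
  move=> At; split; first by have := At ord0.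
  by move=> i; have := At (lift ord0 i); rewrite tnthS.
move=> [Ax At] i; have [j ->|->//] := unliftP ord0 i.
by rewrite tnthS; exact: At.
Qed.

Let row_of_tuple_box d (a b : 'rV[R]_d) :
  @row_of_tuple R d @^-1` [set x | forall i, a 0 i <= x 0 i < b 0 i] =
  [set t | forall i, [set` `[a 0 i, b 0 i[] (tnth t i)].
Proof.
by apply/seteqP; split => t /= abt i; move: (abt i); rewrite in_itv /= mxE.
Qed.

Let measurable_row_of_tuple_box d (a b : 'rV[R]_d) : measurable
  (@row_of_tuple R d @^-1` [set x | forall i, a 0 i <= x 0 i < b 0 i]).
Proof.
rewrite row_of_tuple_box.
exact: (@measurable_tuple_box d (fun i => [set` `[a 0 i, b 0 i[])
  (fun i => measurable_itv _)).
Qed.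

Lemma measurable_lebesgue_box d (a b : 'rV[R]_d) :
  measurable ([set x | forall i, a 0 i <= x 0 i < b 0 i] : set (Rd R d)).
Proof.
move=> X; exact: (caratheodory_measurable_mu_ext (tuple_lebesgue R d)
  (measurable_row_of_tuple_box a b)).
Qed.

Lemma lebesgue_box d (a b : 'rV[R]_d) : (forall i, a 0 i <= b 0 i) ->
  lebesgue ([set x | forall i, a 0 i <= x 0 i < b 0 i] : set (Rd R d)) =
  (\prod_(i < d) (b 0 i - a 0 i))%:E.
Proof.
move=> ab; rewrite /lebesgue /outer_lebesgue.
rewrite (measurable_mu_extE _ (measurable_row_of_tuple_box a b)) row_of_tuple_box.
apply: etrans (@tuple_lebesgue_box d (fun i => [set` `[a 0 i, b 0 i[])
  (fun i => measurable_itv _)) _.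
rewrite -prodEFin; apply: eq_bigr => i _.
rewrite lebesgue_measure_itv /= lte_fin; case: ltP => // ba.
by congr _%:E; apply/esym/eqP; rewrite subr_eq0 eq_le ba ab.
Qed.

End box_volume.

Section weights.
Context {R : realType} {d : nat}.
Implicit Types (w f : Rd R d -> R) (Q : set (Rd R d)).
Local Notation leb := (@lebesgue R d).

Definition loc_integrable f :=
  measurable_fun [set: Rd R d] f /\
  forall K : set 'rV[R]_d, compact K ->
    (\int[leb]_(x in (K : set (Rd R d))) `|f x|%:E < +oo)%E.

Definition weight w := loc_integrable w /\ forall x, 0 < w x.

(** Cubes are taken half-open, so that the dyadic cubes of a given generation
    partition the space; the faces of a cube are Lebesgue-negligible. *)
Definition cube (a : 'rV[R]_d) (h : R) : set (Rd R d) :=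
  [set x : 'rV[R]_d | forall i, a 0 i <= x 0 i < a 0 i + h].

Definition cubes : set (set (Rd R d)) :=
  [set Q | exists a h, 0 < h /\ Q = cube a h].

Definition dyadic_cubes : set (set (Rd R d)) :=
  [set Q | exists (N : int) (k : 'rV[int]_d),
     Q = cube (\row_i (2 ^ (- N) * (k 0 i)%:~R)) (2 ^ (- N))].

Definition volume Q : R := fine (leb Q).

Definition average Q f : \bar R :=
  ((volume Q)^-1%:E * \int[leb]_(x in Q) (f x)%:E)%E.

Definition muckenhoupt_const (r : R) w : \bar R :=
  ereal_sup [set (average Q w *
                  average Q (fun x => w x `^ (- 1 / (r - 1)))%R `^ (r - 1))%E
            | Q in cubes].

Definition muckenhoupt (r : R) w :=
  weight w /\ (muckenhoupt_const r w < +oo)%E.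

(** The functions measured are extended-real valued because a maximal function
    may be infinite at some points. *)
Definition weighted_norm (p : R) (om : Rd R d -> R) (f : Rd R d -> \bar R) :
    \bar R :=
  ((\int[leb]_x (`|f x| `^ p * (om x)%:E)) `^ p^-1)%E.

Definition dyadic_maximal (alpha : R) f (x : Rd R d) : \bar R :=
  ereal_sup [set ((volume Q `^ (alpha / d%:R - 1))%R%:E *
                  \int[leb]_(u in Q) `|f u|%:E)%E
            | Q in [set Q | dyadic_cubes Q /\ Q x]].

End weights.

(* Main.v *)
(* Write f = |phi|, th = alpha/d, t = q - s, tau = p t / q, and let h w be the
   density f^tau w^(1 - tau th), so that h^(q/t) w = f^p w^(p/q).  Then
     f = (f^p w^(p/q))^th (h w)^(1/t) (w^(-1/(r-1)))^((r-1)/t) 1^(1 - th - r/t),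
   with nonnegative exponents of sum 1.  Hoelder's inequality on a cube Q and
   the A_r condition give
     |Q|^(th-1) int_Q f <= ||phi||^(p th) [w]_(A_r)^(1/t) (mean of h over Q)^(1/t),
   the mean being taken with respect to w dx; all powers of |Q| cancel.  It
   remains to bound the dyadic maximal function of h in L^(q/t)(w dx) with
   Doob's constant (q/t)' = q/s.  This is proved by induction on the number of
   generations with Burkholder's function, hence without weak-type estimates. *)

Require Import Defs.
From mathcomp Require Import all_boot all_order all_algebra.
From mathcomp Require Import all_classical all_reals all_analysis measurable_realfun.
From mathcomp Require Import ring lra zify.

Set Implicit Arguments.
Unset Strict Implicit.
Unset Printing Implicit Defensive.

Import Order.TTheory GRing.Theory Num.Theory.
Import numFieldNormedType.Exports.

Local Open Scope classical_set_scope.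
Local Open Scope ring_scope.

(** * Convexity inequalities for real powers *)

Section real_inequalities.
Context {R : realType}.
Implicit Types (x y a l r : R).

(** Weighted arithmetic-geometric mean inequality for the ratios [a i / c i]. The right-hand side is
    linear in the [a i], so it can be integrated term by term. *)
Lemma prod_powR_le_sum (I : finType) (th a c : I -> R) :
  (forall i, 0 <= th i) -> \sum_i th i = 1 ->
  (forall i, 0 <= a i) -> (forall i, 0 < c i) ->
  \prod_i a i `^ th i <= (\prod_i c i `^ th i) * \sum_i th i * (a i / c i).
Proof.
move=> th0 th1 a0 c0.
have rhs0 : 0 <= (\prod_i c i `^ th i) * \sum_i th i * (a i / c i).
  apply: mulr_ge0; first by apply: prodr_ge0 => i _; exact: powR_ge0.
  by apply: sumr_ge0 => i _; rewrite mulr_ge0// divr_ge0// ltW.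
(* A vanishing [a i] with nonzero exponent makes the left-hand side 0; otherwise each factor can be
   written with an exponential. *)
have [[i /andP[ai0 thi0]]|nz] := pselect (exists i, (a i == 0) && (th i != 0)).
  by rewrite (bigD1 i)//= (eqP ai0) powR0// mul0r.
have aE i : a i `^ th i = c i `^ th i * expR (th i * ln (a i / c i)).
  have [ai0|ai0] := eqVneq (a i) 0.
    have -> : th i = 0.
      by apply/eqP/negPn/negP => thi; apply: nz; exists i; rewrite ai0 eqxx.
    by rewrite !powRr0 mul0r expR0 mulr1.
  have ai : 0 < a i by rewrite lt_neqAle eq_sym ai0 a0.
  rewrite -{1}[a i](divfK (lt0r_neq0 (c0 i))) mulrC powRM ?divr_ge0// ?ltW//.
  by congr (_ * _); rewrite /powR mulf_eq0 invr_eq0 (negPf ai0) gt_eqF.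
under eq_bigr do rewrite aE.
rewrite big_split/= ler_wpM2l//; first by apply: prodr_ge0 => i _; exact: powR_ge0.
rewrite -expR_sum; set m := \sum_i _.
(* Jensen for [expR], from [1 + z <= expR z] at [z = ln (a i / c i) - m] *)
have -> : expR m = \sum_i th i * ((1 + (ln (a i / c i) - m)) * expR m).
  under eq_bigr do rewrite mulrA mulrDr mulr1 mulrBr.
  by rewrite -mulr_suml big_split/= sumrB -mulr_suml th1 mul1r subrr addr0 mul1r.
apply: ler_sum => i _; have [->|thi] := eqVneq (th i) 0; first by rewrite !mul0r.
have ai : a i / c i \is Num.pos.
  rewrite posrE divr_gt0// lt_neqAle eq_sym a0 andbT.
  by apply/negP => ai0; apply: nz; exists i; rewrite ai0.
rewrite ler_wpM2l// -[leRHS]lnK// -[X in _ <= expR X](subrK m) expRD.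
by rewrite ler_wpM2r ?expR_ge0 ?expR_ge1Dx.
Qed.

(** Young's inequality for the conjugate exponents [r] and [r / (r - 1)], applied to [x] and
    [y ^ (r - 1)]. *)
Lemma young_powR r x y : 1 < r -> 0 <= x -> 0 <= y ->
  r * x * y `^ (r - 1) <= x `^ r + (r - 1) * y `^ r.
Proof.
move=> r1 x0 y0; have r0 : 0 < r by lra.
have r10 : 0 < r - 1 by lra.
have := @conjugate_powR _ x (y `^ (r - 1)) r (r / (r - 1)) x0 (powR_ge0 _ _) r0.
rewrite divr_gt0// => /(_ isT).
rewrite -powRrM mulrCA divff ?mulr1 ?gt_eqF//.
have -> : r^-1 + (r / (r - 1))^-1 = 1 by field; rewrite !gt_eqF.
move=> /(_ erefl) h.
have := ler_wpM2l (ltW r0) h; rewrite mulrDr mulrA => /le_trans; apply.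
rewrite le_eqVlt; apply/orP; left; apply/eqP.
by field; rewrite !gt_eqF.
Qed.

(** For Burkholder's function [U l a = r l^(r - 1) (l - c a)] this is [U (max l a) a <= U l a]. When
    [l <= a], the difference is [c] times the defect in Young's inequality. *)
Lemma burkholder_step r l a : 1 < r -> 0 <= l -> 0 <= a ->
  let c := r / (r - 1) in
  r * Num.max l a `^ r + r * c * l `^ (r - 1) * a <=
  r * l `^ r + r * c * Num.max l a `^ (r - 1) * a.
Proof.
move=> r1 l0 a0 /=; set c := r / (r - 1); case: (leP l a) => [la|_]; last exact: lexx.
have r10 : 0 < r - 1 by lra.
have -> : r * c * a `^ (r - 1) * a = r * c * a `^ r.
  by rewrite -mulrA [a `^ _ * _]mulrC mulr_powRB1//; lra.
rewrite -subr_ge0.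
have -> : r * l `^ r + r * c * a `^ r - (r * a `^ r + r * c * l `^ (r - 1) * a) =
   c * (a `^ r + (r - 1) * l `^ r - r * a * l `^ (r - 1)).
  by rewrite /c; field; rewrite gt_eqF.
apply: mulr_ge0; first by rewrite /c divr_ge0//; lra.
by rewrite subr_ge0 young_powR.
Qed.

(** Burkholder's function [U l x] majorises [l^r - c^r x^r], by Young's inequality for [c * x] and
    [l]. *)
Lemma burkholder_tangent r l x : 1 < r -> 0 <= l -> 0 <= x ->
  let c := r / (r - 1) in
  l `^ r + r * c * l `^ (r - 1) * x <= c `^ r * x `^ r + r * l `^ r.
Proof.
move=> r1 l0 x0 /=; set c := r / (r - 1).
have c0 : 0 <= c by rewrite /c divr_ge0//; lra.
rewrite -powRM//.
have := @young_powR r (c * x) l r1 (mulr_ge0 c0 x0) l0.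
lra.
Qed.

End real_inequalities.

(** * Comparison of nonnegative integrals *)

Section integral_inequalities.
Local Open Scope ereal_scope.
Context d (T : measurableType d) (R : realType).
Variable mu : {measure set T -> \bar R}.

(* unlike [ge0_le_integral], no measurability is required *)
Lemma ge0_le_integral_subset (D E : set T) (f g : T -> \bar R) :
  D `<=` E -> (forall x, D x -> 0 <= f x) -> (forall x, E x -> 0 <= g x) ->
  (forall x, D x -> f x <= g x) ->
  \int[mu]_(x in D) f x <= \int[mu]_(x in E) g x.
Proof.
move=> DE f0 g0 fg; rewrite !ge0_integralE//.
apply: ereal_sup_le => _ [h /= hf <-]; exists h => //= x.
apply: le_trans (hf x) _; rewrite !patchE.
case: ifPn => [/set_mem Dx|_]; first by rewrite mem_set ?fg//; exact: DE.
by case: ifPn => [/set_mem /g0|].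
Qed.

End integral_inequalities.

(** * Hoelder's inequality for several factors, and vanishing integrals *)

Section integral_powR.
Local Open Scope ereal_scope.
Context d (T : measurableType d) (R : realType).
Variable mu : {measure set T -> \bar R}.
Variable D : set T.
Hypothesis mD : measurable D.

Lemma measurable_fun_powR (f : T -> R) (r : R) :
  measurable_fun D f -> measurable_fun D (fun x => f x `^ r)%R.
Proof. by move=> mf; exact: (measurableT_comp (measurable_powR r)). Qed.

Lemma ge0_integral_linear (a b : R) (f g : T -> \bar R) :
  (0 <= a)%R -> (0 <= b)%R ->
  measurable_fun D f -> (forall x, 0 <= f x) ->
  measurable_fun D g -> (forall x, 0 <= g x) ->
  \int[mu]_(x in D) (a%:E * f x + b%:E * g x) =
  a%:E * \int[mu]_(x in D) f x + b%:E * \int[mu]_(x in D) g x.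
Proof.
move=> a0 b0 mf f0 mg g0; rewrite ge0_integralD//.
- by rewrite !ge0_integralZl_EFin.
- by move=> x _; rewrite mule_ge0.
- exact: measurable_funeM.
- by move=> x _; rewrite mule_ge0.
- exact: measurable_funeM.
Qed.

(** The weighted arithmetic-geometric mean inequality is integrated. Only positive bounds [c i] on
    the integrals enter, so that division by them is possible. *)
Lemma generalized_hoelder (I : finType) (th c : I -> R) (X : I -> T -> R) :
  (forall i, 0 <= th i)%R -> (\sum_i th i = 1)%R ->
  (forall i x, 0 <= X i x)%R -> (forall i, measurable_fun D (X i)) ->
  (forall i, 0 < c i)%R -> (forall i, \int[mu]_(x in D) (X i x)%:E <= (c i)%:E) ->
  \int[mu]_(x in D) (\prod_i X i x `^ th i)%:E <= (\prod_i c i `^ th i)%:E.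
Proof.
move=> th0 th1 X0 mX c0 Xc; set C := (\prod_i c i `^ th i)%R.
have C0 : (0 <= C)%R by apply: prodr_ge0 => i _; exact: powR_ge0.
have thc0 i : (0 <= th i / c i)%R by rewrite divr_ge0// ltW.
have mEX i : measurable_fun D (fun x => (X i x)%:E) by exact/measurable_EFinP.
have S0 i x : 0 <= (th i / c i)%:E * (X i x)%:E by rewrite mule_ge0// lee_fin.
pose S x := \sum_i (th i / c i)%:E * (X i x)%:E.
apply: (@le_trans _ _ (\int[mu]_(x in D) (C%:E * S x))).
  apply: ge0_le_integral_subset => // x _.
  - by rewrite lee_fin; apply: prodr_ge0 => i _; exact: powR_ge0.
  - apply: mule_ge0; rewrite ?lee_fin//; exact: sume_ge0.
  - rewrite /S; under [in leRHS]eq_bigr do rewrite -EFinM.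
    rewrite sumEFin -EFinM lee_fin.
    apply: le_trans (prod_powR_le_sum th0 th1 (X0^~ x) c0) _.
    rewrite ler_wpM2l// ler_sum// => i _.
    by rewrite mulrA mulrAC.
have mS i : measurable_fun D (fun x => (th i / c i)%:E * (X i x)%:E).
  exact: measurable_funeM.
rewrite ge0_integralZl_EFin//; last 2 first.
- by move=> x _; exact: sume_ge0.
- exact: emeasurable_sum.
rewrite -[leRHS]mule1 lee_wpmul2l ?lee_fin//.
rewrite ge0_integral_sum//.
rewrite -[leRHS]/((1%R)%:E) -th1 -sumEFin; apply: lee_sum => i _.
rewrite ge0_integralZl_EFin//; last by move=> x _; rewrite lee_fin.
apply: (@le_trans _ _ ((th i / c i)%:E * (c i)%:E)).
  by rewrite lee_wpmul2l ?lee_fin.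
by rewrite -EFinM divfK// gt_eqF.
Qed.

(** Since [g] is positive, [f ^ r], and with it [f], vanishes almost everywhere. This settles the
    cases in which Hoelder's inequality would need a zero bound. *)
Lemma integral_eq0_powR (f g : T -> R) (r : R) : r != 0%R ->
  measurable_fun D f -> measurable_fun D g ->
  (forall x, 0 <= f x)%R -> (forall x, 0 < g x)%R ->
  \int[mu]_(x in D) (f x `^ r * g x)%:E = 0 -> \int[mu]_(x in D) (f x)%:E = 0.
Proof.
move=> r0 mf mg f0 g0 fg0.
have mfg : measurable_fun D (fun x => (f x `^ r * g x)%:E).
  by apply/measurable_EFinP; apply: measurable_funM => //; exact: measurable_fun_powR.
have [h _] := ae_eq_integral_abs mu mD mfg.
have : ae_eq mu D (fun x => (f x `^ r * g x)%:E) (cst 0).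
  apply: h; rewrite -[RHS]fg0; apply: eq_integral => x _.
  by rewrite gee0_abs// lee_fin mulr_ge0 ?powR_ge0 ?ltW.
move=> fgae; rewrite -(integral0 mu D); apply: ae_eq_integral => //.
  exact/measurable_EFinP.
apply: filterS fgae => x fgx Dx; have /eqP := fgx Dx.
rewrite /= eqe mulf_eq0 (gt_eqF (g0 x)) orbF powR_eq0 r0 andbT => /eqP ->.
by [].
Qed.

(** Otherwise the preceding lemma, for the constant function 1 and exponent 1, would give [D]
    measure zero. *)
Lemma integral_gt0 (g : T -> R) : measurable_fun D g -> (forall x, 0 < g x)%R ->
  0 < mu D -> 0 < \int[mu]_(x in D) (g x)%:E.
Proof.
move=> mg g0 muD; rewrite lt_neqAle eq_sym integral_ge0 ?andbT; last first.
  by move=> x _; rewrite lee_fin ltW.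
apply/eqP => h.
have := @integral_eq0_powR (cst 1%R) g 1%R (oner_neq0 _) (measurable_cst _) mg.
move=> /(_ (fun=> ler01) g0).
under eq_integral do rewrite powR1 mul1r.
move=> /(_ h); rewrite -[X in X = _]/(\int[mu]_(x in D) cst 1 x) integral_cst// mul1e => mu0.
by rewrite mu0 ltxx in muD.
Qed.

End integral_powR.

(** * Cubes: measurability, volume and finiteness of integrals *)

Section cubes.
Context {R : realType} {d : nat}.
Local Notation leb := (@lebesgue R d).
Implicit Types (a : 'rV[R]_d) (h : R).

Lemma cubeE a h : cube a h =
  [set x | forall i, a 0 i <= x 0 i < (\row_i (a 0 i + h)) 0 i].
Proof. by apply/seteqP; split=> x /= ax i; have := ax i; rewrite mxE. Qed.

Lemma measurable_cube a h : measurable (cube a h).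
Proof. by rewrite cubeE; exact: measurable_lebesgue_box. Qed.

Lemma lebesgue_cube a h : 0 <= h -> leb (cube a h) = (h ^+ d)%:E.
Proof.
move=> h0; rewrite cubeE lebesgue_box; last by move=> i; rewrite mxE lerDl.
congr _%:E; under eq_bigr do rewrite mxE addrC addKr.
by rewrite big_const_ord iter_mulr_1.
Qed.

Lemma lebesgue_cube_gt0 a h : 0 < h -> (0 < leb (cube a h))%E.
Proof. by move=> h0; rewrite lebesgue_cube ?ltW// lte_fin exprn_gt0. Qed.

(** The half-open cube lies in a compact closed box. *)
Lemma loc_integrable_cube (f : Rd R d -> R) a h : loc_integrable f ->
  (\int[leb]_(x in cube a h) `|f x|%:E < +oo)%E.
Proof.
case=> _ fK.
have cK : compact [set x : 'rV[R]_d | forall i, `[a 0 i, a 0 i + h]%classic (x ord0 i)].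
  by apply: (@rV_compact _ _ (fun i => `[a 0 i, a 0 i + h]%classic)) => i; exact: segment_compact.
apply: le_lt_trans (fK _ cK); apply: ge0_le_integral_subset => //.
move=> x ax i /=; have /andP[ax1 /ltW ax2] := ax i.
by rewrite in_itv /= ax1.
Qed.

End cubes.

(** * Dyadic cubes *)

Section dyadic.
Context {R : realType} {d : nat}.
Local Notation leb := (@lebesgue R d).
Implicit Types (N : int) (k : 'rV[int]_d) (x : 'rV[R]_d).

Definition dyadic N k : set (Rd R d) :=
  cube (\row_i (2 ^ (- N) * (k 0 i)%:~R)) (2 ^ (- N)).

Definition dyadic_index N x : 'rV[int]_d := \row_i Num.floor (2 ^ N * x 0 i).

(** Scaled by [2 ^ N], the inequalities of the cube are those that characterise the floor.
    Disjointness and covering thus become statements on indices. *)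
Lemma dyadicP N k x : dyadic N k x <-> dyadic_index N x = k.
Proof.
have p0 : 0 < (2 : R) ^ N by rewrite exprz_gt0.
have e i : ((\row_i (2 ^ (- N) * (k 0 i)%:~R) : 'rV[R]_d) 0 i <= x 0 i <
    (\row_i (2 ^ (- N) * (k 0 i)%:~R) : 'rV[R]_d) 0 i + 2 ^ (- N)) =
    ((k 0 i)%:~R <= 2 ^ N * x 0 i < (k 0 i + 1)%:~R).
  rewrite mxE -[X in _ + X]mulr1 -mulrDr intrD.
  by rewrite -invr_expz ler_pdivrMl// ltr_pdivlMl.
split=> [xk|kE i].
  apply/rowP => i; rewrite mxE; apply/eqP; rewrite floor_eq.
  by have := xk i; rewrite e.
by rewrite e -kE !mxE floor_itv.
Qed.

Lemma measurable_dyadic N k : measurable (dyadic N k).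
Proof. exact: measurable_cube. Qed.

Lemma dyadic_disjoint N k k' x : dyadic N k x -> dyadic N k' x -> k = k'.
Proof. by move=> /dyadicP <- /dyadicP <-. Qed.

(** The bit [e i] selects the lower or the upper half of the parent along coordinate [i]. *)
Definition dyadic_child k (e : {ffun 'I_d -> bool}) : 'rV[int]_d :=
  \row_i (2 * k 0 i + (e i)%:Z).

Lemma dyadic_child_inj k : injective (dyadic_child k).
Proof.
move=> e e' /rowP ee; apply/ffunP => i; have := ee i; rewrite !mxE => /addrI.
by case: (e i) (e' i) => -[].
Qed.

Lemma dyadic_children N k : dyadic N k =
  \big[setU/set0]_(e : {ffun 'I_d -> bool}) dyadic (N + 1) (dyadic_child k e).
Proof.
(* The floor of a doubled number is twice the floor plus a bit, which tells the half containing
   [x]. *)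
have step x i : let m := Num.floor (2 ^ N * x 0 i) in let y := 2 ^ (N + 1) * x 0 i in
    Num.floor y = 2 * m + ((2 * m + 1)%:~R <= y)%R%:Z.
  move=> m y; have yE : y = 2 * (2 ^ N * x 0 i).
    by rewrite /y exprzDr ?unitfE// expr1z mulrAC mulrC mulrA.
  have /andP[] := floor_itv (2 ^ N * x 0 i); rewrite -/m => m1 m2.
  move: m2; rewrite intrD => m2; apply/eqP; rewrite floor_eq.
  have [] := leP (2 * m + 1)%:~R y; rewrite yE !(intrD, intrM) /= => h;
    apply/andP; split; lra.
rewrite -bigcup_seq; apply/seteqP; split=> [x /dyadicP/rowP xk|x [e _ /dyadicP/rowP xe]].
  exists [ffun i => (2 * k 0 i + 1)%:~R <= 2 ^ (N + 1) * x 0 i].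
    by rewrite /= mem_index_enum.
  apply/dyadicP/rowP => i; have := xk i; rewrite !mxE ffunE => <-.
  exact: step.
apply/dyadicP/rowP => i; have := xe i; rewrite !mxE step /=.
case: (_ <= _); case: (e i) => /=; lia.
Qed.

Lemma integral_dyadic_children N k (f : Rd R d -> \bar R) :
  measurable_fun setT f -> (forall x, 0 <= f x)%E ->
  (\int[leb]_(x in dyadic N k) f x =
   \sum_(e : {ffun 'I_d -> bool})
     \int[leb]_(x in dyadic (N + 1) (dyadic_child k e)) f x)%E.
Proof.
move=> mf f0; rewrite dyadic_children ge0_integral_bigsetU//.
- by move=> e; exact: measurable_dyadic.
- exact: index_enum_uniq.
- move=> e e' _ _ [x [xe xe']]; apply: (@dyadic_child_inj k).
  exact: dyadic_disjoint xe xe'.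
- exact: measurable_funS mf.
Qed.

(** A function of the index is constant on each of countably many cubes, so its preimages are
    countable unions of cubes. *)
Lemma measurable_dyadic_index (F : 'rV[int]_d -> R) N :
  measurable_fun setT (fun x : Rd R d => F (dyadic_index N x)).
Proof.
move=> _ Y _; rewrite setTI.
rewrite (_ : _ @^-1` _ = \bigcup_k (if F k \in Y then dyadic N k else set0)).
  apply: countable_bigcupT_measurable => // k.
  by case: ifPn => // _; exact: measurable_dyadic.
apply/seteqP; split => [x /= Yx|x [k _]].
  by exists (dyadic_index N x) => //; rewrite mem_set//; exact/dyadicP.
by case: ifPn => // /set_mem Yk /dyadicP /= ->.
Qed.

Lemma ge0_le_integral_dyadic N (f g : Rd R d -> \bar R) (c : R) :
  measurable_fun setT f -> (forall x, 0 <= f x)%E ->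
  measurable_fun setT g -> (forall x, 0 <= g x)%E ->
  (forall k, \int[leb]_(x in dyadic N k) f x <=
             c%:E * \int[leb]_(x in dyadic N k) g x)%E ->
  (\int[leb]_x f x <= c%:E * \int[leb]_x g x)%E.
Proof.
move=> mf f0 mg g0 fg.
(* The cubes of generation [N] are enumerated by the codes of their indices; a number that codes no
   index gives the empty set. *)
pose F n := if pickle_inv n is Some k then dyadic N k else set0.
have mF n : measurable (F n).
  by rewrite /F; case: pickle_inv => // k; exact: measurable_dyadic.
have TF : [set: Rd R d] = \bigcup_n F n.
  apply/seteqP; split => // x _; exists (pickle (dyadic_index N x)) => //.
  by rewrite /F pickleK_inv; exact/dyadicP.
have tF : trivIset setT F.
  move=> n m _ _; rewrite /F.
  have := @pickle_invK 'rV[int]_d n; have := @pickle_invK 'rV[int]_d m.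
  case: pickle_inv => [k|] /=; last by move=> _ _ [x []].
  case: pickle_inv => [l|] /=; last by move=> _ _ [x []].
  by move=> <- <- [x [xl xk]]; rewrite (dyadic_disjoint xl xk).
rewrite TF !ge0_integral_bigcup//; try by apply: measurable_funS mf || apply: measurable_funS mg.
rewrite -nneseriesZl; last by move=> n _; exact: integral_ge0.
apply: lee_nneseries => n _; first by move=> _; exact: integral_ge0.
by rewrite /F; case: pickle_inv => [k|]; [exact: fg|rewrite !integral_set0 mule0].
Qed.

End dyadic.

(** * Doob's inequality for the weighted dyadic means *)

Section weighted_dyadic_maximal.
Context {R : realType} {d : nat}.
Local Notation leb := (@lebesgue R d).
Variables (w h : Rd R d -> R) (rho : R).
Hypothesis mw : measurable_fun setT w.
Hypothesis w0 : forall x, 0 < w x.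
Hypothesis wfin : forall N k, (\int[leb]_(x in dyadic N k) (w x)%:E < +oo)%E.
Hypothesis mh : measurable_fun setT h.
Hypothesis h0 : forall x, 0 <= h x.
Hypothesis rho1 : 1 < rho.
Hypothesis hfin : (\int[leb]_x (h x `^ rho * w x)%:E < +oo)%E.

(** The mean is taken with respect to [w dx]. Under the hypotheses of the section both integrals are
    finite, so [fine] loses nothing. *)
Definition dyadic_mean (N : int) (x : Rd R d) : R :=
  fine (\int[leb]_(u in dyadic N (dyadic_index N x)) (h u * w u)%:E) /
  fine (\int[leb]_(u in dyadic N (dyadic_index N x)) (w u)%:E).

(** The value [l] carries the maximum over coarser generations through the induction. *)
Definition dyadic_running_max (N : int) (m : nat) (l : R) (x : Rd R d) : R :=
  \big[Num.max/l]_(i < m) dyadic_mean (N + i%:Z) x.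

Local Notation M := dyadic_running_max.
Local Notation c := (rho / (rho - 1)).

Let c0 : 0 <= c. Proof. by move: rho1 => r1; rewrite divr_ge0//; lra. Qed.

Let mhw : measurable_fun setT (fun x => (h x * w x)%:E).
Proof. by apply/measurable_EFinP; exact: measurable_funM. Qed.

Let mhrw : measurable_fun setT (fun x => (h x `^ rho * w x)%:E).
Proof.
by apply/measurable_EFinP; apply: measurable_funM; [exact: measurable_fun_powR|exact: mw].
Qed.

Let hw0 x : (0 <= (h x * w x)%:E)%E.
Proof. by rewrite lee_fin mulr_ge0// ltW. Qed.

Let hrw0 x : (0 <= (h x `^ rho * w x)%:E)%E.
Proof. by rewrite lee_fin mulr_ge0 ?powR_ge0// ltW. Qed.

Let hrw_fin N k : (\int[leb]_(x in dyadic N k) (h x `^ rho * w x)%:E < +oo)%E.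
Proof. by apply: le_lt_trans hfin; exact: ge0_le_integral_subset. Qed.

(** The bound [h <= 1 + h ^ rho] reduces the claim to the integrals of [w] and [h ^ rho * w]. *)
Lemma integral_dyadic_lty N k :
  (\int[leb]_(x in dyadic N k) (h x * w x)%:E < +oo)%E.
Proof.
have mD := @measurable_dyadic R d N k.
have mw' : measurable_fun (dyadic N k) (EFin \o w).
  by apply/measurable_EFinP; exact: measurable_funS mw.
have mhrw' := measurable_funS measurableT (@subsetT _ (dyadic N k)) mhrw.
have Ew0 x : (0 <= (EFin \o w) x)%E by rewrite lee_fin ltW.
apply: (@le_lt_trans _ _ (\int[leb]_(x in dyadic N k)
    (1%:E * (EFin \o w) x + 1%:E * (h x `^ rho * w x)%:E))%E).
  apply: ge0_le_integral_subset => // x _; rewrite !mul1e; first exact: adde_ge0.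
  rewrite -EFinD lee_fin -[X in X + _]mul1r -mulrDl ler_pM2r//.
  have [h1|/ltW h1] := leP 1 (h x).
    by rewrite ler_wpDl// le1r_powR// ltW.
  by rewrite ler_wpDr// powR_ge0.
rewrite (ge0_integral_linear _ mD ler01 ler01 mw' Ew0 mhrw' hrw0).
by rewrite !mul1e lte_add_pinfty// (wfin, hrw_fin).
Qed.

Let w_gt0 N k : (0 < \int[leb]_(x in dyadic N k) (w x)%:E)%E.
Proof.
apply: integral_gt0 => //; [exact: measurable_dyadic|exact: measurable_funS mw|].
by apply: lebesgue_cube_gt0; rewrite exprz_gt0.
Qed.

Lemma dyadic_mean_ge0 N x : 0 <= dyadic_mean N x.
Proof.
rewrite divr_ge0// fine_ge0//; apply: integral_ge0 => u _ //.
by rewrite lee_fin ltW.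
Qed.

Lemma measurable_dyadic_mean N : measurable_fun setT (dyadic_mean N).
Proof.
exact: (@measurable_dyadic_index R d (fun k =>
  fine (\int[leb]_(u in dyadic N k) (h u * w u)%:E) /
  fine (\int[leb]_(u in dyadic N k) (w u)%:E)) N).
Qed.

Lemma le_running_max N m l x : l <= M N m l x.
Proof. exact: bigmax_ge_id. Qed.

Lemma mean_le_running_max N m l x i : (i < m)%N ->
  dyadic_mean (N + i%:Z) x <= M N m l x.
Proof.
move=> im.
exact: (le_bigmax _ (fun i : 'I_m => dyadic_mean (N + i%:Z) x) (Ordinal im)).
Qed.

(** The coarsest mean is absorbed into the starting value, the form used by the induction on
    generations. *)
Lemma running_maxS N m l x :
  M N m.+1 l x = M (N + 1) m (Num.max l (dyadic_mean N x)) x.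
Proof.
have shift (i : 'I_m) : N + (lift ord0 i)%:Z = N + 1 + i%:Z.
  by rewrite /= /bump /= PoszD addrA.
rewrite /M big_ord_recl addr0; apply/le_anti/andP; split.
  rewrite ge_max; apply/andP; split.
    by apply: le_trans (bigmax_ge_id _ _ _ _); rewrite le_max lexx orbT.
  apply/bigmax_leP; split => [|i _].
    by apply: le_trans (bigmax_ge_id _ _ _ _); rewrite le_max lexx.
  by rewrite shift; exact: (le_bigmax _ (fun i : 'I_m => dyadic_mean (N + 1 + i%:Z) x)).
apply/bigmax_leP; split => [|i _].
  rewrite ge_max [X in _ && X]le_max lexx andbT.
  by rewrite le_max; apply/orP; right; exact: bigmax_ge_id.
rewrite le_max; apply/orP; right; rewrite -shift.
exact: (le_bigmax _ (fun i : 'I_m => dyadic_mean (N + (lift ord0 i)%:Z) x)).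
Qed.

Lemma measurable_running_max N m l : measurable_fun setT (M N m l).
Proof.
elim: m N => [|m IH] N.
  by rewrite (_ : M N 0 l = cst l)//; apply/funext => x; rewrite /M big_ord0.
rewrite (_ : M N m.+1 l = dyadic_mean N \max M (N + 1) m l).
  by apply: measurable_maxr; [exact: measurable_dyadic_mean|exact: IH].
apply/funext => x; rewrite /M big_ord_recl addr0; congr Num.max.
by apply: eq_bigr => i _; rewrite /= /bump /= PoszD addrA.
Qed.

Let mMw N m l : measurable_fun setT (fun x => (M N m l x `^ rho * w x)%:E).
Proof.
apply/measurable_EFinP; apply: measurable_funM; last exact: mw.
by apply: measurable_fun_powR; exact: measurable_running_max.
Qed.

Let Mw0 N m l x : (0 <= (M N m l x `^ rho * w x)%:E)%E.
Proof. by rewrite lee_fin mulr_ge0 ?powR_ge0// ltW. Qed.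

(* Burkholder's function [rho l ^ (rho - 1) (l - c a)], with [l] the running
   maximum and [a] the current mean, is a supermartingale along the grids;
   both sides are arranged so that no subtraction occurs. *)
Lemma burkholder_dyadic m N k l : 0 <= l ->
  (\int[leb]_(x in dyadic N k) (M N m l x `^ rho * w x)%:E +
     (rho * c * l `^ (rho - 1))%:E * \int[leb]_(x in dyadic N k) (h x * w x)%:E <=
   (c `^ rho)%:E * \int[leb]_(x in dyadic N k) (h x `^ rho * w x)%:E +
     (rho * l `^ rho)%:E * \int[leb]_(x in dyadic N k) (w x)%:E)%E.
Proof.
have r0 : 0 <= rho by move: rho1 => r1; lra.
have mEw : measurable_fun setT (EFin \o w) by exact/measurable_EFinP.
have Ew0 x : (0 <= (EFin \o w) x)%E by rewrite lee_fin ltW.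
have fin (f : Rd R d -> \bar R) D : (forall x, 0 <= f x)%E ->
    (\int[leb]_(x in D) f x < +oo -> \int[leb]_(x in D) f x \is a fin_num)%E.
  by move=> f0 ?; rewrite ge0_fin_numE//; exact: integral_ge0.
(* The cube and [l] vary, since a step passes to the children with a new starting value. With no
   generation left, [burkholder_tangent] times [w] is integrated. *)
elim: m N k l => [|m IH] N k l l0.
  have mD := @measurable_dyadic R d N k.
  have k0 : 0 <= rho * c * l `^ (rho - 1).
    by apply: mulr_ge0; [exact: mulr_ge0|exact: powR_ge0].
  have k1 : 0 <= rho * l `^ rho by rewrite mulr_ge0 ?powR_ge0.
  have mhw' := measurable_funS measurableT (@subsetT _ (dyadic N k)) mhw.
  have mhrw' := measurable_funS measurableT (@subsetT _ (dyadic N k)) mhrw.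
  have mEw' := measurable_funS measurableT (@subsetT _ (dyadic N k)) mEw.
  have mM' := measurable_funS measurableT (@subsetT _ (dyadic N k)) (mMw N 0 l).
  rewrite -[X in (X + _)%E]mul1e.
  rewrite -(ge0_integral_linear _ mD ler01 k0 mM' (Mw0 N 0 l) mhw' hw0).
  rewrite -(ge0_integral_linear _ mD (powR_ge0 c rho) k1 mhrw' hrw0 mEw' Ew0).
  have E0 r f : 0 <= r -> (0 <= f -> 0 <= r%:E * f)%E by move=> ? ?; rewrite mule_ge0.
  apply: ge0_le_integral_subset => // x Dx.
  - by apply: adde_ge0; apply: E0.
  - by apply: adde_ge0; apply: E0 => //; exact: powR_ge0.
  rewrite mul1e.
  rewrite -!EFinM -!EFinD lee_fin !mulrA -!mulrDl ler_pM2r//.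
  rewrite /M big_ord0 -[rho * rho / _]mulrA; exact: burkholder_tangent.
pose k' := dyadic_child k; set a := fine (\int[leb]_(u in dyadic N k) (h u * w u)%:E) /
  fine (\int[leb]_(u in dyadic N k) (w u)%:E).
have a0 : 0 <= a.
  apply: divr_ge0; apply: fine_ge0; apply: integral_ge0 => u _; first exact: hw0.
  exact: Ew0.
set l' := Num.max l a.
have l'0 : 0 <= l' by rewrite le_max l0.
have -> : (\int[leb]_(x in dyadic N k) (M N m.+1 l x `^ rho * w x)%:E =
    \int[leb]_(x in dyadic N k) (M (N + 1) m l' x `^ rho * w x)%:E)%E.
  apply: eq_integral => x /set_mem /dyadicP xk.
  by rewrite running_maxS /dyadic_mean xk.
(* The mean [a] is constant on the cube, so all children share the starting value [l'], and the
   induction hypothesis is summed over them. *)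
have step : (\int[leb]_(x in dyadic N k) (M (N + 1) m l' x `^ rho * w x)%:E +
     (rho * c * l' `^ (rho - 1))%:E * \int[leb]_(x in dyadic N k) (h x * w x)%:E <=
   (c `^ rho)%:E * \int[leb]_(x in dyadic N k) (h x `^ rho * w x)%:E +
     (rho * l' `^ rho)%:E * \int[leb]_(x in dyadic N k) (w x)%:E)%E.
  rewrite !(@integral_dyadic_children R d N k)//.
  rewrite !ge0_sume_distrr; try by move=> e _; apply: integral_ge0 => u _; rewrite // lee_fin ltW.
  rewrite -!big_split/=; apply: lee_sum => e _; exact: IH.
have := step.
have Wf := fin _ _ Ew0 (wfin N k).
have Hf := fin _ _ hw0 (integral_dyadic_lty N k).
have Yf := fin _ _ hrw0 (hrw_fin N k).
have W0 := w_gt0 N k.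
(* With the integral of [h * w] written as mean times mass, [burkholder_step] times the mass brings
   [l'] back to [l]. *)
have HE : fine (\int[leb]_(x in dyadic N k) (h x * w x)%:E) =
    a * fine (\int[leb]_(x in dyadic N k) (w x)%:E).
  by rewrite divfK// gt_eqF// fine_gt0// W0 ltey_eq Wf.
clearbody a; set W := (\int[leb]_(x in dyadic N k) (w x)%:E)%E in HE Wf W0 *.
set H := (\int[leb]_(x in dyadic N k) (h x * w x)%:E)%E in HE Hf *.
set Y := (\int[leb]_(x in dyadic N k) (h x `^ rho * w x)%:E)%E in Yf *.
set X := (\int[leb]_(x in dyadic N k) (M (N + 1) m l' x `^ rho * w x)%:E)%E.
have X0 : (0 <= X)%E by apply: integral_ge0 => x _; exact: Mw0.
clearbody W H Y X.
rewrite -(fineK Wf) -(fineK Hf) -(fineK Yf) -!EFinM.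
case: X X0 => [x| |//] _; last by rewrite -!EFinD addye// leye_eq.
rewrite -!EFinD !lee_fin => XY.
have := ler_wpM2r (fine_ge0 (ltW W0)) (burkholder_step rho1 l0 a0).
move: XY; rewrite HE -/l'.
move: (fine Y) (fine W) (l `^ (rho - 1)) (l' `^ (rho - 1)) => y z u v.
move: (l `^ rho) (l' `^ rho) (c `^ rho) => s t e.
lra.
Qed.

(** Starting from 0 removes both correction terms of [burkholder_dyadic]; the bounds are then summed
    over generation [N]. *)
Lemma integral_running_max N m :
  (\int[leb]_x (M N m 0 x `^ rho * w x)%:E <=
   (c `^ rho)%:E * \int[leb]_x (h x `^ rho * w x)%:E)%E.
Proof.
apply: (@ge0_le_integral_dyadic R d N _ _ _ (mMw N m 0) (Mw0 N m 0) mhrw hrw0) => k.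
have := burkholder_dyadic m N k (lexx 0).
have r0 : rho != 0 by move: rho1 => r1; rewrite gt_eqF//; lra.
have r10 : rho - 1 != 0 by move: rho1 => r1; rewrite gt_eqF//; lra.
by rewrite !powR0// !mulr0 !mul0e !adde0.
Qed.

(* Doob's inequality, with a pointwise majorant in place of the maximal function *)
Lemma dyadic_doob : exists S : Rd R d -> \bar R,
  [/\ measurable_fun setT S,
      forall x, (0 <= S x)%E,
      forall N x, ((dyadic_mean N x `^ rho)%:E <= S x)%E &
      (\int[leb]_x (S x * (w x)%:E) <=
       (c `^ rho)%:E * \int[leb]_x (h x `^ rho * w x)%:E)%E].
Proof.
have r0 : 0 <= rho by move: rho1 => r1; lra.
(* The window of generations from [-n] to [n] has [n.*2.+1] members and exhausts all generations. *)
pose g n x := (M (- n%:Z) n.*2.+1 0 x `^ rho * w x)%:E.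
have ndg x : nondecreasing_seq (g ^~ x).
  move=> n m nm; rewrite lee_fin ler_pM2r// ge0_ler_powR// ?nnegrE;
    try exact: le_running_max.
  apply/bigmax_leP; split => [|i _]; first exact: le_running_max.
  have im : (i + (m - n) < m.*2.+1)%N by have := ltn_ord i; lia.
  have -> : - n%:Z + i%:Z = - m%:Z + (i + (m - n))%N%:Z by lia.
  exact: mean_le_running_max.
pose L x := limn (g ^~ x).
have gL n x : (g n x <= L x)%E.
  rewrite /L (cvg_lim _ (ereal_nondecreasing_cvgn (ndg x)))//.
  by apply: ereal_sup_ubound; exists n.
have L0 x : (0 <= L x)%E by apply: le_trans (gL 0%N x); exact: Mw0.
have wK x : ((w x)^-1%:E * (w x)%:E = 1)%E by rewrite -EFinM mulVf// gt_eqF.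
(* The monotone limit [L] contains the factor [w], which is divided out. *)
exists (fun x => L x * (w x)^-1%:E)%E; split.
- apply: emeasurable_funM.
    apply: (emeasurable_fun_cvg g); first by move=> n; exact: mMw.
    move=> x _; apply: ereal_nondecreasing_is_cvgn; exact: ndg.
  apply/measurable_EFinP; under eq_fun do rewrite -powR_inv1 ?ltW//.
  exact: measurable_fun_powR.
- by move=> x; rewrite mule_ge0// lee_fin invr_ge0 ltW.
- move=> N x /=; rewrite -[leLHS]mule1 -(wK x) muleCA [leRHS]muleC.
  apply: lee_wpmul2l; first by rewrite lee_fin invr_ge0 ltW.
  apply: le_trans (gL `|N|%N x); rewrite lee_fin ler_pM2r//.
  rewrite ge0_ler_powR// ?nnegrE ?dyadic_mean_ge0 ?le_running_max//.
  (* Generation [N] has position [N + |N|] in the window that starts at [-|N|]. *)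
  have iN : (`|(N + `|N|%N%:Z)%R|%N < `|N|%N.*2.+1)%N by lia.
  rewrite [X in dyadic_mean X](_ : N = - `|N|%N%:Z + `|(N + `|N|%N%:Z)%R|%N%:Z); last by lia.
  exact: mean_le_running_max.
- under eq_integral do rewrite -muleA wK mule1.
  rewrite (monotone_convergence _ measurableT) => [||n x _|x _]; last 3 first.
  + by move=> n; exact: mMw.
  + exact: Mw0.
  + exact: ndg.
  apply: lime_le; last by apply: nearW => n; exact: integral_running_max.
  apply: ereal_nondecreasing_is_cvgn => n m nm.
  apply: ge0_le_integral_subset => // x _; [exact: Mw0|exact: Mw0|exact: ndg].
Qed.

End weighted_dyadic_maximal.

(** * Testing the fractional average on a cube *)

Section muckenhoupt.
Context {R : realType} {d : nat}.
Local Notation leb := (@lebesgue R d).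
Implicit Types (w : Rd R d -> R) (a : 'rV[R]_d) (h r A : R).

Lemma average_cube a h f : 0 < h ->
  average (cube a h) f = ((h ^+ d)^-1%:E * \int[leb]_(x in cube a h) (f x)%:E)%E.
Proof. by move=> h0; rewrite /average /volume lebesgue_cube// ltW. Qed.

Lemma weight_cube w a h : weight w -> 0 < h ->
  exists2 W, 0 < W & (\int[leb]_(x in cube a h) (w x)%:E = W%:E)%E.
Proof.
move=> [lw w0] h0; have mw := lw.1.
have W0 : (0 < \int[leb]_(x in cube a h) (w x)%:E)%E.
  apply: integral_gt0; [exact: measurable_cube| |exact: w0|].
    exact: (measurable_funS measurableT (@subsetT _ _) mw).
  exact: lebesgue_cube_gt0.
have Woo : (\int[leb]_(x in cube a h) (w x)%:E < +oo)%E.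
  apply: le_lt_trans (loc_integrable_cube a h lw).
  by apply: ge0_le_integral_subset => // x _; rewrite lee_fin;
    [exact: ltW|exact: ler_norm].
move: W0 Woo; case: integral => [W|//|//]; rewrite lte_fin => W0 _.
by exists W.
Qed.

Lemma measurable_weight_powR w r (D : set (Rd R d)) : weight w ->
  measurable_fun D (fun x => w x `^ r).
Proof.
move=> [[mw _] _]; apply: measurable_fun_powR.
exact: (measurable_funS measurableT (@subsetT _ D) mw).
Qed.

(** The A_r condition on a single cube, solved for the integral of the dual weight. *)
Lemma integral_dual_weight_le w a h r A W : weight w -> 1 < r -> 0 < h ->
  (muckenhoupt_const r w <= A%:E)%E ->
  0 < W -> (\int[leb]_(x in cube a h) (w x)%:E = W%:E)%E ->
  (\int[leb]_(x in cube a h) (w x `^ (- 1 / (r - 1)))%:E <=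
   (h ^+ d * (A * h ^+ d / W) `^ (r - 1)^-1)%:E)%E.
Proof.
move=> ww r1 h0 wA W0 WE; set V := h ^+ d.
have V0 : 0 < V by rewrite exprn_gt0.
have r10 : 0 < r - 1 by rewrite subr_gt0.
have : (average (cube a h) w *
    average (cube a h) (fun x => w x `^ (- 1 / (r - 1)))%R `^ (r - 1) <= A%:E)%E.
  by apply: le_trans wA; apply: ereal_sup_ubound; exists (cube a h) => //; exists a, h.
rewrite !average_cube// WE -/V.
have : (0 <= \int[leb]_(x in cube a h) (w x `^ (- 1 / (r - 1)))%:E)%E.
  by apply: integral_ge0 => x _; rewrite lee_fin powR_ge0.
have r10' : r - 1 != 0 by rewrite gt_eqF.
(* An infinite integral would make the product of averages infinite, against the bound [A]. *)
case: integral => [S|_|//]; last first.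
  rewrite gt0_muley ?lte_fin ?invr_gt0// poweRyr//.
  by rewrite gt0_muley ?mule_gt0 ?lte_fin ?invr_gt0.
rewrite -!EFinM !lee_fin => S0 SA.
have {}SA : (V^-1 * S) `^ (r - 1) <= A * V / W.
  by rewrite ler_pdivlMr// [leLHS]mulrC -ler_pdivrMr// [leLHS]mulrAC [W / V]mulrC.
rewrite -ler_pdivrMl//.
have VS0 : 0 <= V^-1 * S by rewrite mulr_ge0// invr_ge0 ltW.
rewrite -[leLHS]powRr1// -[X in _ `^ X <= _](divff r10') powRrM.
by apply: ge0_ler_powR; rewrite ?invr_ge0 ?nnegrE ?powR_ge0 ?(le_trans _ SA) ?powR_ge0// ltW.
Qed.

(** Hoelder's inequality on the unit cube for [1 = w^(1/r) sg^((r - 1)/r)], raised to the power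
    [r]. *)
Lemma muckenhoupt_const_ge1 w r : weight w -> 1 < r ->
  (1 <= muckenhoupt_const r w)%E.
Proof.
move=> ww r1; have r10 : 0 < r - 1 by rewrite subr_gt0.
have r0 : 0 < r by apply: lt_trans r1.
pose Q : set (Rd R d) := cube 0 1; pose sg x := w x `^ (- 1 / (r - 1)).
have mQ : measurable Q by exact: measurable_cube.
have [W W0 WE] := weight_cube (0 : 'rV[R]_d) ww ltr01.
apply: (@le_trans _ _ (average Q w * average Q sg `^ (r - 1))%E); last first.
  by apply: ereal_sup_ubound; exists Q => //; exists 0, 1.
rewrite !average_cube// WE expr1n invr1 !mul1e.
have msg : measurable_fun Q sg by exact: measurable_weight_powR.
have : (0 < \int[leb]_(x in Q) (sg x)%:E)%E.
  apply: integral_gt0; [exact: mQ|exact: msg| |exact: lebesgue_cube_gt0].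
  by move=> x; rewrite powR_gt0//; exact: ww.2.
rewrite -/Q; case SE : integral => [S| |//] S0; last first.
  by rewrite poweRyr ?gt_eqF// gt0_muley// leey.
rewrite poweR_EFin -EFinM lee_fin.
pose th (i : 'I_2) : R := nth 0 [:: r^-1; (r - 1) / r] i.
pose c (i : 'I_2) : R := nth 0 [:: W; S] i.
pose X (i : 'I_2) : Rd R d -> R := nth w [:: w; sg] i.
have := @generalized_hoelder _ _ _ leb Q mQ _ th c X.
rewrite !big_ord_recl !big_ord0 /th /c /= !mulr1 addr0.
have th0 (i : 'I_2) : 0 <= th i.
  by case: i => [[|[|i]] im]//; rewrite /th/= ?divr_ge0 ?invr_ge0// ltW.
move=> /(_ th0).
have -> : r^-1 + (r - 1) / r = 1 by field; rewrite gt_eqF.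
move=> /(_ erefl).
have X0 (i : 'I_2) x : 0 <= X i x.
  by case: i => [[|[|i]] im]//; rewrite /X/= ?powR_ge0// ltW// ww.2.
have mX (i : 'I_2) : measurable_fun Q (X i).
  case: i => [[|[|i]] im]//.
  exact: measurable_funS ww.1.1.
have cc0 (i : 'I_2) : 0 < c i by case: i => [[|[|i]] im].
have Xc (i : 'I_2) : (\int[leb]_(x in Q) (X i x)%:E <= (c i)%:E)%E.
  by case: i => [[|[|i]] im]//; rewrite /X/= /c /= ?WE ?SE.
move=> /(_ X0 mX cc0 Xc).
have XE x : \prod_i X i x `^ th i = 1.
  rewrite !big_ord_recl big_ord0 /X /th/= mulr1 /sg -powRrM.
  rewrite -powRD; last by rewrite (gt_eqF (ww.2 x)) implybT.
  by rewrite (_ : _ + _ = 0) ?powRr0//; field; rewrite !gt_eqF.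
under eq_integral do rewrite XE.
rewrite -[X in (X <= _)%E]/(\int[leb]_(x in Q) cst 1 x)%E integral_cst//.
rewrite mul1e => WS.
have {WS} : (leb Q <= (W `^ r^-1 * S `^ ((r - 1) / r))%:E)%E by exact: WS.
rewrite lebesgue_cube// expr1n lee_fin => WS.
have {}WS : 1 `^ r <= (W `^ r^-1 * S `^ ((r - 1) / r)) `^ r.
  by apply: ge0_ler_powR; rewrite ?nnegrE ?mulr_ge0 ?powR_ge0// ltW.
move: WS; rewrite powR1 powRM ?powR_ge0// -!powRrM mulVf ?gt_eqF// divfK ?gt_eqF//.
by rewrite powRr1// ltW.
Qed.

End muckenhoupt.

(** * Arithmetic of the exponents *)

Section exponents.
Context {R : realType}.
Variables p q th r : R.
Hypotheses (p1 : 1 < p) (pq : p <= q) (qp : 1 / q = 1 / p - th).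
Hypotheses (r1 : 1 < r) (rr : r < q / (p / (p - 1)) + 1).

Local Notation D := ((r - 1) * (q - p) + p * q).
(* the paper's q - s *)
Definition hoelder_exponent := r * q ^+ 2 / D.
Local Notation t := hoelder_exponent.

Let p0 : 0 < p. Proof. by move: p1; lra. Qed.
Let q0 : 0 < q. Proof. by move: p0 pq; lra. Qed.
Let D0 : 0 < D.
Proof.
apply: ltr_wpDl; last by rewrite mulr_gt0.
by apply: mulr_ge0; move: r1 pq; lra.
Qed.

Let rp : r * p < q * (p - 1) + p.
Proof.
move: rr; rewrite invf_div mulrA -ltrBlDr ltr_pdivlMr//; lra.
Qed.

Lemma fractional_orderE : th = 1 / p - 1 / q. Proof. by rewrite qp; ring. Qed.

Lemma fractional_order_ge0 : 0 <= th.
Proof. by rewrite fractional_orderE subr_ge0 !div1r lef_pV2 ?posrE. Qed.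

Lemma hoelder_exponent_gt0 : 0 < t.
Proof. by rewrite divr_gt0// mulr_gt0 ?exprn_gt0//; move: r1; lra. Qed.

(** Clearing denominators gives [r * p < q * (p - 1) + p], the upper limit on [r]. Hence [s = q - t]
    is positive. *)
Lemma hoelder_exponent_lt : t < q.
Proof.
rewrite ltr_pdivrMr// expr2 mulrCA -subr_gt0 -mulrBr mulr_gt0//.
by rewrite subr_gt0; move: rp; lra.
Qed.

(** This is the exponent left for the constant function 1. Its numerator is [q - p] times the gap in
    [rp]. *)
Lemma slack_exponent_ge0 : 0 <= 1 - th - r / t.
Proof.
have -> : 1 - th - r / t = (q - p) * (q * (p - 1) + p - r * p) / (p * q ^+ 2).
  rewrite fractional_orderE /t; field.
  by rewrite !gt_eqF//; move: r1; lra.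
rewrite divr_ge0 ?mulr_ge0 ?exprn_ge0 ?subr_ge0 ?(ltW p0) ?(ltW q0) ?(ltW rp)//.
Qed.

End exponents.

(** * Fractional averages of [phi] against weighted means of [rescaled] *)

Section testing.
Context {R : realType} {d : nat}.
Local Notation leb := (@lebesgue R d).
Variables p q th r : R.
Hypotheses (p1 : 1 < p) (pq : p <= q) (qp : 1 / q = 1 / p - th).
Hypotheses (r1 : 1 < r) (rr : r < q / (p / (p - 1)) + 1).
Variables w phi : Rd R d -> R.
Hypotheses (ww : weight w) (mphi : measurable_fun setT phi).

Local Notation t := (hoelder_exponent p q r).
Local Notation tau := (p * t / q).
Let p0 : 0 < p. Proof. by move: p1; lra. Qed.
Let q0 : 0 < q. Proof. by move: p0 pq; lra. Qed.
Let t0 : 0 < t. Proof. exact: hoelder_exponent_gt0. Qed.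
Let tau0 : 0 < tau. Proof. by rewrite divr_gt0// mulr_gt0. Qed.

Definition rescaled (x : Rd R d) : R := `|phi x| `^ tau * w x `^ (- (tau * th)).

Let mabs : measurable_fun setT (fun x => `|phi x|).
Proof. exact: measurableT_comp. Qed.

Lemma measurable_rescaled : measurable_fun setT rescaled.
Proof.
by apply: measurable_funM; [exact: measurable_fun_powR|exact: measurable_weight_powR].
Qed.

Lemma rescaled_ge0 x : 0 <= rescaled x.
Proof. by rewrite mulr_ge0 ?powR_ge0. Qed.

(** The exponent of [w] becomes [1 - p * th], which is [p / q] by the relation between the
    exponents. *)
Lemma rescaled_powR x :
  rescaled x `^ (q / t) * w x = `|phi x| `^ p * w x `^ (p / q).
Proof.
have wx := ww.2 x.
rewrite powRM ?powR_ge0// -!powRrM -mulrA; congr (_ `^ _ * _).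
  by field; rewrite !gt_eqF.
rewrite -[X in _ * X](powRr1 (ltW wx)) -powRD; last by rewrite (gt_eqF wx) implybT.
by congr (_ `^ _); rewrite (fractional_orderE qp); field; rewrite !gt_eqF.
Qed.

(** The exponents of [phi] add up to [p * th + p / q = 1], those of [w] to 0. *)
Lemma phi_factorization x : `|phi x| =
  (`|phi x| `^ p * w x `^ (p / q)) `^ th * (rescaled x * w x) `^ t^-1 *
  (w x `^ (- 1 / (r - 1))) `^ ((r - 1) / t).
Proof.
have wx := ww.2 x; rewrite /rescaled.
(* Both sides vanish at a zero of [phi]; elsewhere logarithms reduce the identity to its
   exponents. *)
have [->|phi0] := eqVneq (phi x) 0.
  have t_neq0 : t^-1 != 0 by rewrite invr_eq0 gt_eqF.
  by rewrite normr0 (powR0 (lt0r_neq0 tau0)) !mul0r (powR0 t_neq0) mulr0 mul0r.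
have : 0 < `|phi x| by rewrite normr_gt0.
move: wx; rewrite -!lnK_eq => /eqP <- /eqP <-.
rewrite -!(expRM, expRD); congr expR.
rewrite (fractional_orderE qp); field.
by rewrite !gt_eqF//; move: r1; lra.
Qed.

Lemma fractional_average_le a l W H A N :
  0 < l -> 0 < A -> (muckenhoupt_const r w <= A%:E)%E ->
  (\int[leb]_(x in cube a l) (w x)%:E = W%:E)%E -> 0 < W ->
  (\int[leb]_(x in cube a l) (rescaled x * w x)%:E = H%:E)%E ->
  (\int[leb]_x (`|phi x| `^ p * w x `^ (p / q))%:E = N%:E)%E -> 0 < N ->
  (((l ^+ d) `^ (th - 1))%:E * \int[leb]_(x in cube a l) `|phi x|%:E <=
   (N `^ th * A `^ t^-1 * (H / W) `^ t^-1)%:E)%E.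
Proof.
move=> l0 A0 wA WE W0 HE NE N0; set Q : set (Rd R d) := cube a l.
set V := l ^+ d; have V0 : 0 < V by rewrite exprn_gt0.
have mQ : measurable Q by exact: measurable_cube.
have mabsQ : measurable_fun Q (fun x => `|phi x|).
  exact: (measurable_funS measurableT (@subsetT _ Q) mabs).
have mwQ b : measurable_fun Q (fun x => w x `^ b) by exact: measurable_weight_powR.
have mwQ1 : measurable_fun Q w.
  exact: (measurable_funS measurableT (@subsetT _ Q) ww.1.1).
have H0 : 0 <= H.
  rewrite -lee_fin -HE; apply: integral_ge0 => x _.
  by rewrite lee_fin mulr_ge0 ?rescaled_ge0// ltW// ww.2.
(* Hoelder's inequality needs positive bounds. If [H = 0], then the integral of [|phi|] over the
   cube is zero. *)
have [H00|H00] := eqVneq H 0.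
  rewrite (@integral_eq0_powR _ _ _ leb Q mQ _
    (fun x => w x `^ (- (tau * th)) * w x) tau).
  - by rewrite mule0 lee_fin !mulr_ge0 ?powR_ge0.
  - by rewrite gt_eqF.
  - exact: mabsQ.
  - by apply: measurable_funM; [exact: mwQ|exact: mwQ1].
  - by [].
  - by move=> x; rewrite mulr_gt0 ?powR_gt0 ?ww.2.
  - by under eq_integral do rewrite mulrA; rewrite HE H00.
have {}H0 : 0 < H by rewrite lt_neqAle eq_sym H00.
(* The exponents belong, in order, to the integrand of the norm, [rescaled * w], the dual weight and
   the constant 1. *)
pose e (i : 'I_4) : R := nth 0 [:: th; t^-1; (r - 1) / t; 1 - th - r / t] i.
pose C := V * (A * V / W) `^ (r - 1)^-1.
pose c (i : 'I_4) : R := nth 0 [:: N; H; C; V] i.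
pose X (i : 'I_4) : Rd R d -> R := nth w [::
  (fun x => `|phi x| `^ p * w x `^ (p / q)); (fun x => rescaled x * w x);
  (fun x => w x `^ (- 1 / (r - 1))); cst 1] i.
have e0 (i : 'I_4) : 0 <= e i.
  case: i => [[|[|[|[|i]]]] im]//; rewrite /e/=.
  - exact: fractional_order_ge0 qp.
  - by rewrite invr_ge0 ltW.
  - by rewrite divr_ge0// ltW// subr_gt0.
  - exact: slack_exponent_ge0.
have e1 : \sum_i e i = 1.
  rewrite !big_ord_recl big_ord0 /e/=; field; rewrite gt_eqF//.
have X0 (i : 'I_4) x : 0 <= X i x.
  by case: i => [[|[|[|[|i]]]] im]//; rewrite /X/= ?powR_ge0// mulr_ge0
    ?powR_ge0 ?rescaled_ge0// ltW// ww.2.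
have mX (i : 'I_4) : measurable_fun Q (X i).
  case: i => [[|[|[|[|i]]]] im]; rewrite /X/=.
  - by apply: measurable_funM; [exact: measurable_fun_powR|exact: mwQ].
  - apply: measurable_funM; last exact: mwQ1.
    exact: (measurable_funS measurableT (@subsetT _ Q) measurable_rescaled).
  - exact: mwQ.
  - exact: measurable_cst.
  - by [].
have C0 : 0 < C by rewrite mulr_gt0// powR_gt0// divr_gt0// mulr_gt0.
have c0 (i : 'I_4) : 0 < c i by case: i => [[|[|[|[|i]]]] im].
have Xc (i : 'I_4) : (\int[leb]_(x in Q) (X i x)%:E <= (c i)%:E)%E.
  case: i => [[|[|[|[|i]]]] im]; rewrite /X/= /c/=.
  - rewrite -NE; apply: ge0_le_integral_subset => // x _;
      by rewrite lee_fin mulr_ge0 ?powR_ge0.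
  - by rewrite HE.
  - exact: integral_dual_weight_le.
  - rewrite -[X in (X <= _)%E]/(\int[leb]_(x in Q) cst 1 x)%E integral_cst// mul1e.
    have : (leb Q <= V%:E)%E by rewrite lebesgue_cube// ltW.
    exact.
  - by [].
have := @generalized_hoelder _ _ _ leb Q mQ _ e c X e0 e1 X0 mX c0 Xc.
have XE x : \prod_i X i x `^ e i = `|phi x|.
  rewrite !big_ord_recl big_ord0 /X /e/= powR1 !mulr1 mulrA.
  exact/esym/phi_factorization.
under eq_integral do rewrite XE.
move=> /(lee_wpmul2l (x := (V `^ (th - 1))%:E)) => /(_ _)/le_trans; apply.
  by rewrite lee_fin powR_ge0.
rewrite -EFinM lee_fin le_eqVlt; apply/orP; left; apply/eqP.
rewrite !big_ord_recl big_ord0 /c /e/= /C.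
(* The powers of [V] cancel: [(th - 1) + r / t + (1 - th - r / t) = 0]. *)
move: V0 W0 A0 N0 H0; rewrite -!lnK_eq => /eqP <- /eqP <- /eqP <- /eqP <- /eqP <-.
rewrite -!(expRN, expRM, expRD) mulr1 -!(expRN, expRM, expRD); congr expR.
by field; rewrite !gt_eqF//; move: r1; lra.
Qed.

End testing.

(** * The norm inequality for a single [r] *)

Lemma ge0_lee_poweR (R : realType) (r : R) (x y : \bar R) : (0 <= r)%R ->
  (0 <= x)%E -> (x <= y)%E -> (x `^ r <= y `^ r)%E.
Proof.
move=> r0 x0 xy; apply: gt0_ler_poweR => //; rewrite in_itv/= leey andbT//.
exact: le_trans xy.
Qed.

Section norm_estimate.
Context {R : realType} {d : nat}.
Local Notation leb := (@lebesgue R d).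

(** The supremum runs over a nonempty family, which contains a dyadic cube of side 1. *)
Lemma dyadic_maximal_ge0 (alpha : R) (phi : Rd R d -> R) x :
  (0 <= dyadic_maximal alpha phi x)%E.
Proof.
pose Q : set (Rd R d) := dyadic 0 (dyadic_index 0 x).
apply: (@le_trans _ _ ((volume Q `^ (alpha / d%:R - 1))%:E *
                  \int[leb]_(u in Q) `|phi u|%:E)%E).
  by rewrite mule_ge0 ?lee_fin ?powR_ge0// integral_ge0.
apply: ereal_sup_ubound; exists Q => //; split; last exact/dyadicP.
by exists 0, (dyadic_index 0 x).
Qed.

Lemma weighted_norm_EFin (p b : R) (w phi : Rd R d -> R) :
  weighted_norm p (fun x => w x `^ b) (EFin \o phi) =
  ((\int[leb]_x (`|phi x| `^ p * w x `^ b)%:E) `^ p^-1)%E.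
Proof. by []. Qed.

Variables p q alpha r : R.
Hypotheses (p1 : 1 < p) (pq : p <= q) (qp : 1 / q = 1 / p - alpha / d%:R).
Hypotheses (r1 : 1 < r) (rr : r < q / (p / (p - 1)) + 1).
Variables w phi : Rd R d -> R.
Hypotheses (ww : weight w) (lphi : loc_integrable phi).
Local Notation t := (hoelder_exponent p q r).
Local Notation th := (alpha / d%:R).

Lemma weighted_norm_dyadic_maximal_le A N :
  0 < A -> (muckenhoupt_const r w <= A%:E)%E ->
  (\int[leb]_x (`|phi x| `^ p * w x `^ (p / q))%:E = N%:E)%E -> 0 < N ->
  (weighted_norm q w (dyadic_maximal alpha phi) <=
   (A `^ (1 / t) * (q / (q - t)) `^ (1 / t) * N `^ p^-1)%:E)%E.
Proof.
move=> A0 wA NE N0; have mphi := lphi.1.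
have p0 : 0 < p by move: p1; lra.
have q0 : 0 < q by move: p0 pq; lra.
have t0 : 0 < t := hoelder_exponent_gt0 p1 pq r1.
have tq : t < q := hoelder_exponent_lt p1 pq r1 rr.
have rho1 : 1 < q / t by rewrite ltr_pdivlMr// mul1r.
pose h := rescaled p q th r w phi.
have hE : (\int[leb]_x (h x `^ (q / t) * w x)%:E = N%:E)%E.
  by rewrite -NE; apply: eq_integral => x _; rewrite (rescaled_powR p1 pq qp r1 phi ww).
have wfin N' k : (\int[leb]_(x in dyadic N' k) (w x)%:E < +oo)%E.
  have [|W _ ->] := weight_cube (\row_i (2 ^ (- N') * (k 0 i)%:~R)) (h := 2 ^ (- N')) ww.
    by rewrite exprz_gt0.
  exact: ltry.
have mh : measurable_fun setT h by exact: measurable_rescaled.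
have hfin : (\int[leb]_x (h x `^ (q / t) * w x)%:E < +oo)%E by rewrite hE ltry.
have [S [mS S0 hS]] := @dyadic_doob R d w h (q / t) ww.1.1 ww.2 wfin mh
  (rescaled_ge0 _ _ _ _ _ _) rho1 hfin.
rewrite hE => SN.
pose C := N `^ th * A `^ t^-1.
have C0 : 0 <= C by rewrite mulr_ge0 ?powR_ge0.
(* Because [1 / t = (q / t) / q], the testing bound on any dyadic cube containing [x] is controlled
   by the same [S x ^ (1 / q)]. *)
have MS x : (dyadic_maximal alpha phi x <= C%:E * S x `^ q^-1)%E.
  apply: ge_ereal_sup => _ [Q [[N' [k QE]] Qx] <-].
  have l0 : 0 < (2 : R) ^ (- N') by rewrite exprz_gt0.
  set a := (X in cube X) in QE.
  have xk : dyadic_index N' x = k by apply/dyadicP; rewrite /dyadic -/a -QE.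
  have [W W0 WE] := weight_cube a ww l0.
  have [H HE] : exists H, (\int[leb]_(u in cube a (2 ^ (- N'))) (h u * w u)%:E = H%:E)%E.
    have := integral_dyadic_lty ww.1.1 ww.2 wfin mh (rescaled_ge0 _ _ _ _ _ _) rho1 hfin N' k.
    have : (0 <= \int[leb]_(u in dyadic N' k) (h u * w u)%:E)%E.
      apply: integral_ge0 => u _; rewrite lee_fin mulr_ge0//; first exact: rescaled_ge0.
      exact: ltW (ww.2 u).
    by rewrite /dyadic -/a; case: integral => [H|//|//] _ _; exists H.
  have -> : volume Q = (2 ^ (- N')) ^+ d.
    by rewrite /volume QE lebesgue_cube// ltW.
  rewrite QE.
  apply: le_trans (fractional_average_le p1 pq qp r1 rr ww mphi l0 A0 wA WE W0 HE NE N0) _.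
  rewrite -/C EFinM lee_wpmul2l ?lee_fin//.
  have := hS N' x; rewrite /dyadic_mean xk /dyadic -/a WE HE /= => HS.
  have -> : t^-1 = q / t * q^-1 by field; rewrite !gt_eqF.
  rewrite powRrM -poweR_EFin.
  by apply: ge0_lee_poweR; rewrite ?invr_ge0 ?lee_fin ?powR_ge0 ?(ltW q0).
have wMS : (\int[leb]_x (`|dyadic_maximal alpha phi x| `^ q * (w x)%:E) <=
    (C `^ q * ((q / t / (q / t - 1)) `^ (q / t) * N))%:E)%E.
  apply: (@le_trans _ _ (\int[leb]_x ((C `^ q)%:E * (S x * (w x)%:E)))%E).
    apply: ge0_le_integral_subset => // x _.
    - by rewrite mule_ge0 ?poweR_ge0// lee_fin ltW// ww.2.
    - by rewrite !mule_ge0// lee_fin ?powR_ge0// ltW// ww.2.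
    rewrite gee0_abs ?dyadic_maximal_ge0// muleA.
    apply: lee_wpmul2r; first by rewrite lee_fin ltW// ww.2.
    rewrite -poweR_EFin -[X in (_ <= _ * X)%E]poweRe1// -(mulVf (lt0r_neq0 q0)).
    rewrite poweRrM -poweRM ?lee_fin ?poweR_ge0//.
    by apply: ge0_lee_poweR; rewrite ?(ltW q0) ?dyadic_maximal_ge0.
  rewrite ge0_integralZl_EFin; last 4 first.
  - exact: measurableT.
  - by move=> x _; rewrite mule_ge0// lee_fin ltW// ww.2.
  - apply: emeasurable_funM; first exact: mS.
    by apply/measurable_EFinP; exact: ww.1.1.
  - exact: powR_ge0.
  by rewrite EFinM lee_wpmul2l ?lee_fin ?powR_ge0// EFinM.
apply: (@le_trans _ _ (((C `^ q * ((q / t / (q / t - 1)) `^ (q / t) * N))%:E) `^ q^-1)%E).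
  apply: ge0_lee_poweR wMS; first by rewrite invr_ge0 ltW.
  apply: integral_ge0 => x _.
  by rewrite mule_ge0 ?poweR_ge0// lee_fin ltW// ww.2.
rewrite poweR_EFin lee_fin le_eqVlt; apply/orP; left; apply/eqP.
(* Doob's constant for the exponent [q / t] is [q / s]. *)
have -> : q / t / (q / t - 1) = q / (q - t).
  by field; rewrite ?subr_eq0 !gt_eqF.
have : 0 < q / (q - t) by rewrite divr_gt0// subr_gt0.
rewrite /C; move: N0 A0; rewrite -!lnK_eq => /eqP <- /eqP <- /eqP <-.
rewrite -!(expRM, expRD); congr expR.
(* The exponents of [N] combine by [th + 1 / q = 1 / p]. *)
rewrite (fractional_orderE qp); field.
by rewrite !gt_eqF.
Qed.

End norm_estimate.

(** * Passage to the infimum, with the degenerate norms and constants *)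

Theorem theorem1p3 (R : realType) (d : nat) (alpha p q : R) :
  (1 <= d)%N -> 0 <= alpha < d%:R -> 1 < p -> p <= q ->
  1 / q = 1 / p - alpha / d%:R ->
  let p' := p / (p - 1) in
  let s (r : R) := q - r * q ^+ 2 / ((r - 1) * (q - p) + p * q) in
  forall w : Rd R d -> R, muckenhoupt (q / p' + 1) w ->
  forall phi : Rd R d -> R, loc_integrable phi ->
  (weighted_norm q w (dyadic_maximal alpha phi) <=
   ereal_inf [set muckenhoupt_const r w `^ (1 / (q - s r)) *
                  ((q / s r) `^ (1 / (q - s r)))%R%:E
             | r in [set r : R | (1 < r < q / p' + 1)%R]] *
   weighted_norm p (fun x => (w x `^ (p / q))%R) (EFin \o phi))%E.
Proof.
move=> _ _ p1 pq qp p' s w [ww _] phi lphi.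
have p0 : 0 < p by lra.
have q0 : 0 < q by lra.
have sE r : q - s r = hoelder_exponent p q r by rewrite /s opprB addrC subrK.
set I := ereal_inf _; rewrite weighted_norm_EFin.
(* A positive infimum keeps its product with an infinite norm infinite. *)
have I1 : (1 <= I)%E.
  apply: le_ereal_inf_tmp => _ [r /= /andP[r1 rr] <-]; rewrite sE.
  rewrite -[leLHS]mule1; apply: lee_pmul => //.
    rewrite -(poweR1r (1 / hoelder_exponent p q r)).
    apply: ge0_lee_poweR => //; last exact: muckenhoupt_const_ge1.
    by rewrite divr_ge0// ltW// hoelder_exponent_gt0.
  have t0 := hoelder_exponent_gt0 p1 pq r1.
  have tq := hoelder_exponent_lt p1 pq r1 rr.
  have -> : s r = q - hoelder_exponent p q r by rewrite -sE; lra.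
  rewrite lee_fin.
  have : (1 : R) `^ (1 / hoelder_exponent p q r) <=
      (q / (q - hoelder_exponent p q r)) `^ (1 / hoelder_exponent p q r).
    have qt : 1 <= q / (q - hoelder_exponent p q r).
      by rewrite ler_pdivlMr ?subr_gt0// mul1r lerBlDr lerDl ltW.
    apply: ge0_ler_powR => //; rewrite ?nnegrE// ?(le_trans _ qt)//.
    by rewrite divr_ge0// ltW.
  by rewrite powR1.
set Nn := (\int[_]_x _)%E.
have Nn0 : (0 <= Nn)%E.
  by apply: integral_ge0 => x _; rewrite lee_fin mulr_ge0 ?powR_ge0.
have pV0 : p^-1 != 0 by rewrite invr_eq0 gt_eqF.
case NE : Nn Nn0 => [N| |//]; last first.
  by rewrite poweRyr// gt0_muley ?leey// (lt_le_trans _ I1).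
rewrite lee_fin le_eqVlt => /predU1P[N0|N0].
  (* A zero norm forces the integral of [|phi|] over every dyadic cube to vanish. *)
  have M0 x : dyadic_maximal alpha phi x = 0%E.
    apply/eqP; rewrite eq_le dyadic_maximal_ge0 andbT.
    apply: ge_ereal_sup => _ [Q [[N' [k QE]] Qx] <-].
    rewrite (_ : integral _ _ _ = 0%E) ?mule0//.
    apply: (@integral_eq0_powR _ _ _ (@lebesgue R d) Q _ (fun x => `|phi x|)
      (fun x => w x `^ (p / q)) p).
    - by rewrite QE; exact: measurable_cube.
    - by rewrite gt_eqF.
    - apply: measurableT_comp => //.
      exact: (measurable_funS measurableT (@subsetT _ Q) lphi.1).
    - exact: measurable_weight_powR.
    - by [].
    - by move=> u; rewrite powR_gt0// ww.2.
    - have uw0 u : (0 <= (`|phi u| `^ p * w u `^ (p / q))%:E)%E.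
        by rewrite lee_fin mulr_ge0 ?powR_ge0.
      apply/eqP; rewrite eq_le integral_ge0// andbT.
      apply: (@le_trans _ _ Nn); last by rewrite NE -N0.
      exact: ge0_le_integral_subset.
  rewrite /weighted_norm; under eq_integral do rewrite M0 abse0 poweR0r ?gt_eqF// mul0e.
  rewrite integral0 poweR0r ?invr_eq0 ?gt_eqF//.
  by rewrite mule_ge0 ?poweR_ge0// (le_trans _ I1).
have Np0 : 0 < N `^ p^-1 by rewrite powR_gt0.
(* The norm is now positive and finite; dividing by it allows each [r] to be treated separately. *)
rewrite poweR_EFin -lee_pdivrMr//.
apply: le_ereal_inf_tmp => _ [r /= /andP[r1 rr] <-]; rewrite lee_pdivrMr// sE.
have -> : s r = q - hoelder_exponent p q r by rewrite -sE; lra.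
have t0 := hoelder_exponent_gt0 p1 pq r1.
have tq := hoelder_exponent_lt p1 pq r1 rr.
case AE : (muckenhoupt_const r w) => [A| |].
- have A1 : 1 <= A by rewrite -lee_fin -AE; exact: muckenhoupt_const_ge1.
  rewrite poweR_EFin -!EFinM.
  apply: weighted_norm_dyadic_maximal_le => //; last by rewrite AE.
  exact: lt_le_trans A1.
(* An infinite A_r constant makes the bound for this [r] infinite. *)
- rewrite poweRyr; last by rewrite gt_eqF// divr_gt0.
  rewrite gt0_mulye ?lte_fin ?powR_gt0 ?divr_gt0 ?subr_gt0//.
  by rewrite gt0_mulye ?leey.
- by have := muckenhoupt_const_ge1 ww r1; rewrite AE.
Qed.
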